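(* Let $d\ge 3$ and let $\Box_d$ be the folded $d$-cube. Then $\Box_d$ has $z$-vector $z=d^{\,2^{d-2}(d-1)!}$, i.e. it has exactly $2^{d-2}(d-1)!$ zigzags (up to reversal), all of length $d$ and without self-intersections; and every zigzag has intersection vector $\mathrm{Int}=(0,1)^d$.
   Context: The folded cube $\Box_d$ is the $(d-1)$-dimensional complex obtained from the boundary complex of the $d$-cube $\gamma_d=[-1,1]^d$ by identifying opposite faces: its elements are a smallest element $0$, a greatest element $1$, and the pairs $\{F,-F\}$ of opposite proper nonempty faces of $\gamma_d$ (of dimension $\dim F$), where $\{F,-F\}\le\{G,-G\}$ iff $F\subset G$ or $-F\subset G$. Its flags are the images of flags of $\gamma_d$, i.e. maximal chains $(0,x_1,\dots,x_d,1)$ with $\dim x_i=i-1$. For $1\le i\le d$, $\sigma_i$ is the involution on flags replacing $x_i$ by the unique $x_i'\neq x_i$ with $x_{i-1}\le x_i'\le x_{i+1}$ (where $x_0=0$, $x_{d+1}=1$). Put $T=\sigma_d\sigma_{d-1}\cdots\sigma_1$ ($\sigma_1$ applied first). A zigzag is a circuit $Z=(f_1,\dots,f_l)$ of flags (an orbit of $T$, listed cyclically, up to cyclic shift) with $f_{j+1}=T(f_j)$, indices modulo $l$; $l$ is its length. For a flag $f=(0,x_1,\dots,x_d,1)$ there is a unique family $(x_{i,j})_{1\le i\le d,1\le j\le d+1-i}$ with $x_{i,1}=x_i$, $\dim x_{i,j}=i-1$, $x_{i,j}\le x_{i+1,j}$, $x_{i,j}\le x_{i+1,j-1}$, and $x_{i,j}\ne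 x_{i,j-1}$ whenever the indices make sense; the reverse of $f$ is the flag $f^t=(0,x_{1,d},x_{2,d-1},\dots,x_{d,1},1)$. The reverse of $Z=(f_1,\dots,f_l)$ is the zigzag $Z^t=(f_l^t,\dots,f_1^t)$. A zigzag is identified with its reverse (so zigzags are counted up to reversal). $Z$ has no self-intersections if for no flag $f$ of $Z$ does $\sigma_1(f)$ belong to $Z$ or $Z^t$. For two distinct zigzags $Z_1=(f_{1},\dots,f_{l})$ and $Z_2$, $n_I$ is the number of $j$ with $\sigma_1(f_j)\in Z_2$ and $n_{II}$ the number of $j$ with $\sigma_1(f_j)\in Z_2^t$; replacing $Z_2$ by $Z_2^t$ exchanges the two numbers, and the normalized signature is the pair $(n_I,n_{II})$ with orientation chosen so that $n_I\le n_{II}$. The intersection vector $\mathrm{Int}$ of a zigzag $Z$ is the list of its nonzero normalized signatures with all other zigzags, multiplicities being written as exponents: $(0,1)^d$ means that $Z$ has normalized signature $(0,1)$ with exactly $d$ other zigzags and $(0,0)$ with all remaining ones. *)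

(* Defs.v *)
From HB Require Import structures.
From mathcomp Require Import all_boot all_order all_algebra.
Set Implicit Arguments.
Unset Strict Implicit.
Unset Printing Implicit Defensive.

Import Order.TTheory GRing.Theory Num.Theory.

(* A nonempty face of the cube [-1,1]^d is a product of d factors, each of them
   {1}, {-1} or [-1,1]; these are encoded by Some false, Some true and None
   (b stands for the sign (-1) ^+ b, see in_face).  The whole cube is the
   constant function None. *)
Definition face (d : nat) : finType := {ffun 'I_d -> option bool}.

Definition fdim d (F : face d) : nat := #|[set i | F i == None]|.

Definition fopp d (F : face d) : face d := [ffun i => omap negb (F i)].

Definition fsub d (F G : face d) : bool :=
  [forall i, (G i == None) || (F i == G i)].

Definition proper_face d (F : face d) : bool := [exists i, F i != None].

Section Geometry.
Local Open Scope ring_scope.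

Definition in_face d (R : realDomainType) (F : face d) (x : 'I_d -> R) : Prop :=
  forall i, if F i is Some b then x i = (-1) ^+ b else -1 <= x i <= 1.

Lemma in_face_fopp d (R : realDomainType) (F : face d) (x : 'I_d -> R) :
  in_face (fopp F) x <-> in_face F (fun i => - x i).
Proof.
have bnd (y : R) : (-1 <= - y <= 1) = (-1 <= y <= 1).
  by rewrite lerN2 (lerNl y 1) andbC.
by split=> H i; move: (H i); rewrite ffunE; case: (F i) => [[]|] /=;
  rewrite ?bnd // => E; apply: oppr_inj; rewrite ?E ?opprK // -E opprK.
Qed.

Lemma fsubP d (R : realDomainType) (F G : face d) :
  fsub F G <-> (forall x : 'I_d -> R, in_face F x -> in_face G x).
Proof.
split=> [/forallP sFG x Fx i | sFG].
  have := Fx i; case/orP: (sFG i) => /eqP; last by move=> ->.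
  move=> ->; case: (F i) => [[]|] // ->.
    by rewrite expr1 lexx -subr_ge0 opprK addr_ge0 ?ler01.
  by rewrite expr0 lexx andbT -subr_ge0 opprK addr_ge0 ?ler01.
have two : (0 : R) < 1 + 1 by rewrite addr_gt0 ?ltr01.
pose x i : R := if F i is Some b then (-1) ^+ b else 0.
have Fx : in_face F x.
  move=> i; rewrite /x; case: (F i) => //.
  by rewrite ler01 andbT oppr_le0 ler01.
apply/forallP => i; have := sFG x Fx i; rewrite /x.
have ne : (-1 : R) != 1.
  by rewrite eq_sym -subr_eq0 opprK gt_eqF.
have ne1 : (0 == (-1 : R)) = false by rewrite eq_sym oppr_eq0 oner_eq0.
have ne0 : (0 == (1 : R)) = false by rewrite eq_sym oner_eq0.
case: (F i) => [[]|]; case: (G i) => [[]|] //= /eqP;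
  by rewrite ?expr0 ?expr1 ?ne0 ?ne1 ?(eq_sym 1) ?(negPf ne).
Qed.

End Geometry.

Definition is_fpair d (P : {set face d}) : bool :=
  [exists F, proper_face F && (P == [set F; fopp F])].

Definition fpair (d : nat) : finType := {P : {set face d} | is_fpair P}.

Inductive fcube (d : nat) : Type := FBot | FPair of fpair d | FTop.
Arguments FBot {d}.
Arguments FTop {d}.

Definition fcube_to d (x : fcube d) : option (option (fpair d)) :=
  match x with FBot => None | FTop => Some None | FPair P => Some (Some P) end.
Definition fcube_of d (o : option (option (fpair d))) : fcube d :=
  match o with None => FBot | Some None => FTop | Some (Some P) => FPair P end.
Lemma fcube_toK d : cancel (@fcube_to d) (@fcube_of d).
Proof. by case. Qed.
HB.instance Definition _ d := Finite.copy (fcube d) (can_type (@fcube_toK d)).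

Definition fle d (x y : fcube d) : bool :=
  match x, y with
  | FBot, _ => true
  | _, FTop => true
  | FPair P, FPair Q =>
      [exists F in val P, exists G in val Q, fsub F G]
  | _, _ => false
  end.

(* 1 + dimension; F and -F have the same dimension, so the maximum is their
   common dimension. *)
Definition frank d (x : fcube d) : nat :=
  match x with
  | FBot => 0
  | FPair P => (\max_(F in val P) fdim F).+1
  | FTop => d.+1
  end.

(* f = (x_0, x_1, ..., x_d, x_{d+1}) with x_0 = FBot and x_{d+1} = FTop. *)
Definition is_flag d (f : d.+2.-tuple (fcube d)) : bool :=
  [&& tnth f ord0 == FBot, tnth f ord_max == FTop,
      [forall i : 'I_d.+2, frank (tnth f i) == i]
    & [forall i : 'I_d.+2, forall j : 'I_d.+2,
         (i <= j) ==> fle (tnth f i) (tnth f j)]].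

Definition flag (d : nat) : finType := {f : d.+2.-tuple (fcube d) | is_flag f}.

Definition fnth d (f : flag d) (i : nat) : fcube d := nth FBot (val f) i.

(* The flag that differs from f in position i and nowhere else; for
   1 <= i <= d it exists and is unique, so the default value f is not used. *)
Definition sigma d (i : nat) (f : flag d) : flag d :=
  odflt f [pick g : flag d |
    [forall k : 'I_d.+2, (fnth g k != fnth f k) == (k == i :> nat)]].

Definition zT d (f : flag d) : flag d :=
  foldl (fun g i => sigma i g) f (iota 1 d).

(* x i j stands for x_{i,j}; only the entries with i, j >= 1 and i + j <= d + 1
   are constrained. *)
Definition reverse_family d (f : flag d) (x : nat -> nat -> fcube d) : bool :=
  [forall i : 'I_d.+2, forall j : 'I_d.+2,
    [&& 0 < i, 0 < j & i + j <= d.+1] ==>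
    [&& (j == 1 :> nat) ==> (x i j == fnth f i),
        frank (x i j) == i,
        (i + j <= d) ==> fle (x i j) (x i.+1 j),
        (1 < j) ==> fle (x i j) (x i.+1 j.-1)
      & (1 < j) ==> (x i j != x i j.-1)]].

Definition is_reverse d (f g : flag d) : bool :=
  [exists x : {ffun 'I_d.+2 * 'I_d.+2 -> fcube d},
    let X i j := x (inord i, inord j) in
    reverse_family f X &&
    [forall i : 'I_d.+2, (0 < i <= d) ==> (fnth g i == X i (d.+1 - i))]].

Definition flag_rev d (f : flag d) : flag d :=
  odflt f [pick g : flag d | is_reverse f g].

(* A zigzag (f, T f, T^2 f, ...), up to cyclic shift and with its orientation,
   is determined by its set of flags; its length is the cardinal of this set. *)
Definition zigzag_of d (f : flag d) : {set flag d} :=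
  [set g in orbit (@zT d) f].

Definition zigzags d : {set {set flag d}} := [set zigzag_of f | f : flag d].

Definition zrev d (Z : {set flag d}) : {set flag d} :=
  [set flag_rev f | f in Z].

Definition zclass d (Z : {set flag d}) : {set {set flag d}} := [set Z; zrev Z].

Definition zigzags_upto_reversal d : {set {set {set flag d}}} :=
  [set zclass Z | Z in zigzags d].

Definition no_self_intersection d (Z : {set flag d}) : bool :=
  [forall f in Z, sigma 1 f \notin Z :|: zrev Z].

Definition nI d (Z1 Z2 : {set flag d}) : nat :=
  #|[set f in Z1 | sigma 1 f \in Z2]|.

Definition nII d (Z1 Z2 : {set flag d}) : nat := nI Z1 (zrev Z2).

(* Normalized signature of Z with a zigzag C up to reversal: any of the two
   orientations of C may be picked, since they only exchange nI and nII. *)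
Definition signature d (Z : {set flag d}) (C : {set {set flag d}}) : nat * nat :=
  if [pick Z2 in C] is Some Z2
  then (minn (nI Z Z2) (nII Z Z2), maxn (nI Z Z2) (nII Z Z2))
  else (0, 0).

Definition Int d (Z : {set flag d}) : seq (nat * nat) :=
  [seq s <- [seq signature Z C
              | C <- enum (zigzags_upto_reversal d :\ zclass Z)]
   | s != (0, 0)].

(* Main.v *)
Require Import Defs.
From mathcomp Require Import all_boot perm zify.

(* A flag of the folded cube is a pair (v, r) of a sign vector v, taken up to
   negation, and an ordering of the coordinates in which r(i) is the position
   of i: the flag starts at the vertex v and frees the coordinates in that
   order.  By the diamond property, each exchange of a face in T or in the
   definition of the reverse replaces an interval [l, h) of free positions by
   [l + 1, h + 1), and hence
     - sigma_1 flips the sign of the coordinate in position 0;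
     - T flips that sign and rotates the ordering by one step, so that T^d
       negates v and is the identity, and zigzags have length d;
     - the reverse of a flag has the ordering -2 - r modulo d.
   The cyclic ordering is constant along a zigzag Z and is the opposite one
   along the reverse of Z; as d >= 3 the two differ, so the classes up to
   reversal consist of 2d of the 2^(d-1) d! flags.  The flags sigma_1(f), f in
   Z, all have the cyclic ordering of Z, and up to powers of T they are the d
   flags obtained from a fixed f = (v, r) by flipping one coordinate of v.
   These lie in d distinct zigzags, all of them different from Z and met by Z
   once, with one orientation only. *)

Set Implicit Arguments.
Unset Strict Implicit.
Unset Printing Implicit Defensive.

(** * Faces and elements of the folded cube *)

Section Faces.
Variable d : nat.
Implicit Types (F G H : face d) (x y z : fcube d).

Lemma foppK : involutive (@fopp d).
Proof. by move=> F; apply/ffunP=> i; rewrite !ffunE; case: (F i) => [[]|]. Qed.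

Lemma fopp_eqNone F i : (fopp F i == None) = (F i == None).
Proof. by rewrite ffunE; case: (F i). Qed.

Lemma fdim_fopp F : fdim (fopp F) = fdim F.
Proof. by apply: eq_card => i; rewrite !inE fopp_eqNone. Qed.

Lemma fopp_improper F : ~~ proper_face F -> fopp F = F.
Proof.
rewrite negb_exists => /forallP nF; apply/ffunP=> i; rewrite ffunE.
by have := nF i; rewrite negbK => /eqP ->.
Qed.

Lemma fsub_fopp F G : fsub (fopp F) (fopp G) = fsub F G.
Proof.
by apply: eq_forallb => i; rewrite !ffunE; case: (F i) (G i) => [[]|] [[]|].
Qed.

Lemma fsub_trans : transitive (@fsub d).
Proof.
move=> G F H /forallP sFG /forallP sGH; apply/forallP=> i.
by move: (sFG i) (sGH i); case: (F i) (G i) (H i) => [[]|] [[]|] [[]|].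
Qed.

Lemma fdim_improper F : ~~ proper_face F -> fdim F = d.
Proof.
rewrite negb_exists => /forallP nF; rewrite -[RHS]card_ord -cardsT.
by apply: eq_card => i; rewrite !inE; have := nF i; rewrite negbK.
Qed.

(* The whole cube is its own opposite and represents the greatest element, so
   that every element other than the smallest one is [xi F] for some [F]. *)
Definition xi F : fcube d :=
  if insub [set F; fopp F] is Some P then FPair P else FTop.

Lemma xi_proper F : proper_face F ->
  exists2 P : fpair d, val P = [set F; fopp F] & xi F = FPair P.
Proof.
move=> pF; have fP : is_fpair [set F; fopp F].
  by apply/existsP; exists F; rewrite pF eqxx.
by exists (Sub [set F; fopp F] fP) => //; rewrite /xi insubT.
Qed.

Lemma xi_improper F : ~~ proper_face F -> xi F = FTop.
Proof.
move=> nF; rewrite /xi insubN //; apply/existsP=> -[G /andP[pG /eqP eG]].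
have : G \in [set F; fopp F] by rewrite eG set21.
by rewrite fopp_improper // !inE orbb => /eqP eGF; rewrite -eGF pG in nF.
Qed.

Lemma xi_surj y : y != FBot -> exists F, y = xi F.
Proof.
case: y => [//|P|] _.
  have /existsP[F /andP[pF /eqP eP]] := valP P.
  exists F; have [Q eQ ->] := xi_proper pF.
  by congr FPair; apply: val_inj; rewrite eQ.
exists [ffun=> None]; rewrite xi_improper // negb_exists.
by apply/forallP=> i; rewrite ffunE.
Qed.

Lemma xi_neq_bot F : xi F != FBot.
Proof.
case: (boolP (proper_face F)) => [/xi_proper[P _ ->]//|nF].
by rewrite xi_improper.
Qed.

Lemma frank_xi F : frank (xi F) = (fdim F).+1.
Proof.
case: (boolP (proper_face F)) => [/xi_proper[P eP ->]|nF]; last first.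
  by rewrite xi_improper // fdim_improper.
congr S; apply/eqP; rewrite eqn_leq; apply/andP; split.
  apply/bigmax_leqP => G; rewrite eP !inE.
  by case/orP=> /eqP->; rewrite ?fdim_fopp.
by apply: (@leq_bigmax_cond _ _ (@fdim d)); rewrite eP set21.
Qed.

Lemma fle_xi F G : fle (xi F) (xi G) = fsub F G || fsub (fopp F) G.
Proof.
case: (boolP (proper_face G)) => [pG|nG]; last first.
  rewrite (xi_improper nG) /= [RHS](_ : _ = true); first by case: (xi F).
  apply/orP; left; apply/forallP=> i.
  by move: nG; rewrite negb_exists => /forallP/(_ i); rewrite negbK => ->.
have [Q eQ ->] := xi_proper pG.
case: (boolP (proper_face F)) => [/xi_proper[P eP ->]|nF]; last first.
  rewrite (xi_improper nF) (fopp_improper nF) orbb; apply/esym/negbTE.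
  have /existsP[i nGi] := pG; apply/forallP=> /(_ i).
  move: nF; rewrite negb_exists => /forallP/(_ i); rewrite negbK => /eqP ->.
  by case: (G i) nGi.
apply/existsP/orP => /=.
  case=> F' /andP[]; rewrite eP !inE => eF' /existsP[G' /andP[]].
  rewrite eQ !inE; case/orP: eF' => /eqP-> /orP[]/eqP->; auto.
    by rewrite -fsub_fopp foppK; auto.
  by rewrite -fsub_fopp !foppK; auto.
case=> sFG; [exists F | exists (fopp F)]; rewrite eP ?set21 ?set22 /=;
  by apply/existsP; exists G; rewrite eQ set21.
Qed.

Lemma xi_fopp F : xi (fopp F) = xi F.
Proof. by rewrite /xi foppK setUC. Qed.

Lemma xi_eq F G : xi F = xi G -> F = G \/ F = fopp G.
Proof.
case: (boolP (proper_face F)) => [/xi_proper[P eP ->]|nF];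
  case: (boolP (proper_face G)) => [/xi_proper[Q eQ ->]|nG] //.
- case=> ePQ; have : F \in val P by rewrite eP set21.
  by rewrite ePQ eQ !inE => /orP[]/eqP; auto.
- by rewrite xi_improper.
- by rewrite xi_improper.
move=> _; left; apply/ffunP=> i.
move: nF nG; rewrite !negb_exists => /forallP/(_ i) + /forallP/(_ i).
by rewrite !negbK => /eqP-> /eqP->.
Qed.

Lemma fle_trans : transitive (@fle d).
Proof.
move=> y x z; have [->//|/xi_surj[F ->]] := eqVneq x FBot.
have [->|/xi_surj[G ->]] := eqVneq y FBot.
  by have := xi_neq_bot F; case: (xi F).
have [->|/xi_surj[H ->]] := eqVneq z FBot.
  by have := xi_neq_bot G; case: (xi G).
rewrite !fle_xi => /orP[] sFG /orP[] sGH.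
- by rewrite (fsub_trans sFG sGH).
- by rewrite -fsub_fopp in sFG; rewrite (fsub_trans sFG sGH) orbT.
- by rewrite (fsub_trans sFG sGH) orbT.
by rewrite -fsub_fopp foppK in sFG; rewrite (fsub_trans sFG sGH).
Qed.

Lemma fle_refl : reflexive (@fle d).
Proof.
move=> x; have [->//|/xi_surj[F ->]] := eqVneq x FBot.
by rewrite fle_xi; apply/orP; left; apply/forallP=> i; rewrite eqxx orbT.
Qed.

(** Opposite faces have the same free coordinates, so the choice of a representative does not
    matter; at [FBot] the set is empty. *)
Definition ffree x : {set 'I_d} :=
  [set i | [exists F, (xi F == x) && (F i == None)]].

Lemma ffree_xi F i : (i \in ffree (xi F)) = (F i == None).
Proof.
rewrite inE; apply/existsP/idP => [[G /andP[/eqP/xi_eq[]->]]|Fi].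
- by [].
- by rewrite fopp_eqNone.
by exists F; rewrite eqxx.
Qed.

Lemma card_ffree_xi F : #|ffree (xi F)| = fdim F.
Proof. by apply: eq_card => i; rewrite ffree_xi inE. Qed.

Lemma card_ffree x : x != FBot -> frank x = #|ffree x|.+1.
Proof. by move=> /xi_surj[F ->]; rewrite frank_xi card_ffree_xi. Qed.

Lemma ffree_le x y : fle x y -> ffree x \subset ffree y.
Proof.
have [->|/xi_surj[F ->]] := eqVneq x FBot.
  move=> _; apply/subsetP=> i; rewrite inE => /existsP[F /andP[/eqP eF]].
  by have := xi_neq_bot F; rewrite eF.
have [->|/xi_surj[G ->]] := eqVneq y FBot.
  by have := xi_neq_bot F; case: (xi F).
rewrite fle_xi => sFG; apply/subsetP=> i; rewrite !ffree_xi => /eqP Fi.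
case/orP: sFG => /forallP/(_ i).
  by rewrite Fi eq_sym orbb eq_sym.
by rewrite ffunE Fi eq_sym orbb eq_sym.
Qed.

End Faces.

(** * Flags *)

Section Flags.
Variable d : nat.
Implicit Types (f g : flag d) (x : nat -> fcube d).

Lemma tnth_fnth f (i : 'I_d.+2) : tnth (val f) i = fnth f i.
Proof. exact: tnth_nth. Qed.

Lemma fnth0 f : fnth f 0 = FBot.
Proof. by case/and4P: (valP f) => /eqP + _ _ _; rewrite tnth_fnth. Qed.

Lemma fnth_last f : fnth f d.+1 = FTop.
Proof. by case/and4P: (valP f) => _ /eqP + _ _; rewrite tnth_fnth. Qed.

Lemma frank_fnth f k : k <= d.+1 -> frank (fnth f k) = k.
Proof.
rewrite -ltnS => lekd; case/and4P: (valP f) => _ _ /forallP + _.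
by move=> /(_ (Ordinal lekd))/eqP; rewrite tnth_fnth.
Qed.

Lemma fle_fnth f i j : i <= j -> j <= d.+1 -> fle (fnth f i) (fnth f j).
Proof.
move=> leij lejd; have leid := leq_trans leij lejd; move: leid lejd.
rewrite -!(ltnS _ d.+1) => ltid ltjd.
case/and4P: (valP f) => _ _ _ /forallP/(_ (Ordinal ltid)).
by move=> /forallP/(_ (Ordinal ltjd))/implyP/(_ leij); rewrite !tnth_fnth.
Qed.

Lemma flag_ext f g : (forall k, k < d -> fnth f k.+1 = fnth g k.+1) -> f = g.
Proof.
move=> efg; apply: val_inj; apply: eq_from_tnth => -[[|k] ltkd].
  by rewrite !tnth_fnth !fnth0.
rewrite !tnth_fnth /=; move: ltkd; rewrite !ltnS leq_eqVlt.
by case/predU1P=> [->|/efg//]; rewrite !fnth_last.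
Qed.

Lemma flag_of_fun x :
    x 0 = FBot -> x d.+1 = FTop -> (forall k, k <= d.+1 -> frank (x k) = k) ->
    (forall k, k <= d -> fle (x k) (x k.+1)) ->
  exists f, forall k, k <= d.+1 -> fnth f k = x k.
Proof.
move=> x0 xT rx lex.
have sz : size (mkseq x d.+2) == d.+2 by rewrite size_mkseq.
pose t := Tuple sz.
have tE (i : 'I_d.+2) : tnth t i = x i by rewrite (tnth_nth FBot) nth_mkseq.
have tP : is_flag t.
  apply/and4P; split; rewrite ?tE ?x0 ?xT //.
    by apply/forallP=> i; rewrite tE rx // -ltnS.
  apply/forallP=> i; apply/forallP=> j; apply/implyP; rewrite !tE.
  have : j <= d.+1 by rewrite -ltnS.
  elim: (j : nat) => [|k IHk] lekd.
    by rewrite leqn0 => /eqP->; apply: fle_refl.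
  rewrite leq_eqVlt => /predU1P[->|leik]; first exact: fle_refl.
  by apply: fle_trans (lex _ lekd); apply: IHk => //; apply: ltnW.
exists (Sub t tP) => k lekd; rewrite /fnth SubK.
by rewrite nth_mkseq.
Qed.

(** As [sigma] is a [pick], two things are checked: the flag with [y] inserted exists, so the
    default is not taken, and any flag that is picked has [y] in that place, by the uniqueness in
    the last hypothesis. *)
Lemma sigma_spec g m y : m < d ->
    frank y = m.+1 -> y != fnth g m.+1 ->
    fle (fnth g m) y -> fle y (fnth g m.+2) ->
    (forall z, frank z = m.+1 -> z != fnth g m.+1 ->
       fle (fnth g m) z -> fle z (fnth g m.+2) -> z = y) ->
  forall k, k <= d.+1 ->
    fnth (sigma m.+1 g) k = if k == m.+1 then y else fnth g k.
Proof.
move=> ltmd ry ny ley1 ley2 uy.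
have [h hP] : exists h : flag d, forall k, k <= d.+1 ->
    fnth h k = if k == m.+1 then y else fnth g k.
  apply: flag_of_fun => [|||k lekd].
  - by rewrite fnth0.
  - by rewrite eqSS gtn_eqF // fnth_last.
  - by move=> k lekd; case: eqP => [->//|_]; apply: frank_fnth.
  rewrite eqSS; have [->|nk] := eqVneq k m; first by rewrite ltn_eqF.
  have [->//|_] := eqVneq k m.+1; exact: fle_fnth.
rewrite /sigma; case: pickP => [h' /forallP h'P|/(_ h)/negP[]]; last first.
  apply/forallP=> -[k ltkd]; rewrite [X in (X != _)]hP //=.
  by case: (eqVneq k) => [->|_]; rewrite ?ny ?eqxx.
have eh' k : k <= d.+1 -> k != m.+1 -> fnth h' k = fnth g k.
  rewrite -ltnS => ltkd /negPf nk; have /eqP := h'P (Ordinal ltkd).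
  by rewrite /= nk => /negbFE/eqP.
move=> k lekd; case: eqP => [->|/eqP nk]; last by rewrite /= eh'.
have ltm : m.+1 < d.+2 by lia.
apply: uy => /=.
- by apply: frank_fnth; lia.
- by have /eqP-> := h'P (Ordinal ltm); rewrite /=.
- by rewrite -eh'; [apply: fle_fnth; lia|lia|lia].
- by rewrite -eh'; [apply: fle_fnth; lia|lia|lia].
Qed.

End Flags.

(** * Faces with consecutive free coordinates *)

Section Arcs.
Variable d : nat.
Implicit Types (v w : 'I_d -> bool) (r : 'I_d -> nat) (y : fcube d).

(* [r i] is the position of the coordinate [i] in the order in which the
   coordinates become free along a flag. *)
Definition ranking r : Prop := injective r /\ forall i, r i < d.

Lemma ranking_surj r k : ranking r -> k < d -> exists i, r i = k.
Proof.
case=> inj_r ltr ltkd; pose p i := Ordinal (ltr i).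
have inj_p : injective p by move=> i j /(congr1 val)/inj_r.
have [q _ qK] := injF_bij inj_p.
by exists (q (Ordinal ltkd)); rewrite -[LHS]/(val (p _)) qK.
Qed.

Lemma xi_below y (B : face d) :
  y != FBot -> fle y (xi B) -> exists2 Y, y = xi Y & fsub Y B.
Proof.
move=> /xi_surj[Y ->]; rewrite fle_xi => /orP[sYB|sYB]; first by exists Y.
by exists (fopp Y); rewrite ?xi_fopp.
Qed.

(** First choose the representative [Y] that contains [A]. If [B] is only known to contain the
    opposite of [Y], then it contains both [A] and its opposite; so [B] is the whole cube and
    contains [Y] as well. *)
Lemma xi_between (A B : face d) y :
    fsub A B -> fle (xi A) y -> fle y (xi B) ->
  exists Y, [/\ y = xi Y, fsub A Y & fsub Y B].
Proof.
move=> sAB leAy leyB.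
have /xi_surj[Y0 eY0] : y != FBot.
  by have := xi_neq_bot A; case: (xi A) y leAy {leyB} => [|P|] [|Q|].
have [Y eY sAY] : exists2 Y, y = xi Y & fsub A Y.
  move: leAy; rewrite eY0 fle_xi => /orP[sAY|sAY]; first by exists Y0.
  by exists (fopp Y0); rewrite ?xi_fopp // -fsub_fopp foppK.
exists Y; split=> //; move: leyB; rewrite eY fle_xi => /orP[//|sYB].
apply/forallP=> i; rewrite -fsub_fopp in sAY.
move: (fsub_trans sAY sYB) sAB => /forallP/(_ i) + /forallP/(_ i).
rewrite ffunE; move: sYB => /forallP/(_ i); rewrite ffunE.
by case: (A i) (B i) (Y i) => [[]|] [[]|] [[]|].
Qed.

Definition arc v r l h : face d :=
  [ffun i => if l <= r i < h then None else Some (v i)].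

Lemma arc_eqNone v r l h i : (arc v r l h i == None) = (l <= r i < h).
Proof. by rewrite ffunE; case: ifP. Qed.

Lemma eq_arc v w r r' l h l' h' :
    (forall i, (l <= r i < h) = (l' <= r' i < h')) ->
    (forall i, ~~ (l <= r i < h) -> v i = w i) ->
  arc v r l h = arc w r' l' h'.
Proof.
move=> er ev; apply/ffunP=> i; rewrite !ffunE -er.
by case: ifPn => // /ev->.
Qed.

Lemma fsub_arc v w r l h l' h' :
    (forall i, l <= r i < h -> l' <= r i < h') ->
    (forall i, ~~ (l' <= r i < h') -> v i = w i) ->
  fsub (arc v r l h) (arc w r l' h').
Proof.
move=> sr ev; apply/forallP=> i; rewrite !ffunE.
case: (boolP (l' <= r i < h')) => //= nh; rewrite ev //.
by case: ifPn => // /sr; rewrite (negPf nh).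
Qed.

Lemma fle_arc v w r l h l' h' :
    (forall i, l <= r i < h -> l' <= r i < h') ->
    (forall i, ~~ (l' <= r i < h') -> v i = w i) ->
  fle (xi (arc v r l h)) (xi (arc w r l' h')).
Proof. by move=> sr ev; rewrite fle_xi fsub_arc. Qed.

Lemma fopp_arc v r l h : fopp (arc v r l h) = arc (fun i => ~~ v i) r l h.
Proof. by apply/ffunP=> i; rewrite !ffunE; case: ifP. Qed.

Lemma fdim_arc v r l h : ranking r -> h <= d -> fdim (arc v r l h) = h - l.
Proof.
move=> rk_r; rewrite /fdim; elim: h => [|h IHh] lehd.
  by rewrite sub0n; apply: eq_card0 => i; rewrite !inE arc_eqNone ltn0 andbF.
have [leh|ltlh] := leqP l h; last first.
  by rewrite (eqP ltlh); apply: eq_card0 => i; rewrite !inE arc_eqNone; lia.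
have [a ra] := ranking_surj rk_r lehd.
rewrite subSn // -IHh; last exact: ltnW.
set S := [set i | arc v r l h i == None].
have aS : a \notin S by rewrite inE arc_eqNone ra ltnn andbF.
have -> : #|S|.+1 = #|a |: S| by rewrite cardsU1 aS.
apply: eq_card => i; rewrite !inE !arc_eqNone.
have -> : (i == a) = (r i == h) by rewrite -ra inj_eq //; case: rk_r.
by lia.
Qed.

Lemma frank_arc v r l h :
  ranking r -> h <= d -> frank (xi (arc v r l h)) = (h - l).+1.
Proof. by move=> rk_r lehd; rewrite frank_xi fdim_arc. Qed.

Lemma arc_neq v w r l h : ranking r -> l <= h < d ->
    (forall i, r i != l -> w i = v i) -> (forall i, r i = l -> w i = ~~ v i) ->
  2 <= d ->
  xi (arc w r l.+1 h.+1) != xi (arc v r l h).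
Proof.
move=> rk_r /andP[lelh lthd] ev nv d2.
have [a ra] := ranking_surj rk_r (leq_ltn_trans lelh lthd).
have [ltlh|hlel] := ltnP l h.
  apply/eqP=> /xi_eq[]/ffunP/(_ a);
    by rewrite !ffunE ra ltnn leqnn ltlh.
have elh : h = l by apply/eqP; rewrite eqn_leq lelh hlel.
rewrite {h lelh hlel}elh in lthd *; apply/eqP=> /xi_eq[]/ffunP.
  by move/(_ a); rewrite !ffunE ra ltnn !leqnn nv //=; case: (v a).
(* The two vertices differ in the coordinate [a] only; any second coordinate shows that they are not
   opposite. *)
have [b rb] : exists b, r b = (if l == 0 then 1 else 0).
  by apply: ranking_surj => //; case: ifP; lia.
move/(_ b); rewrite !ffunE ev; last by rewrite rb; case: ifP; lia.
rewrite (_ : (l < _ < _) = false); last by lia.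
rewrite (_ : (l <= _ < l) = false); last by lia.
by case: (v b).
Qed.

(* The faces between [arc w r l.+1 h] and [arc v r l h.+1] are [arc v r l h]
   and [arc w r l.+1 h.+1].  When [l = h] the lower bound is dropped and these
   are the two vertices of an edge. *)
Lemma arc_diamond v w r l h y : ranking r -> l <= h < d ->
    (forall i, r i != l -> w i = v i) -> (forall i, r i = l -> w i = ~~ v i) ->
    frank y = (h - l).+1 -> y != xi (arc v r l h) ->
    (l < h -> fle (xi (arc w r l.+1 h)) y) -> fle y (xi (arc v r l h.+1)) ->
  y = xi (arc w r l.+1 h.+1).
Proof.
move=> rk_r /andP[lelh lthd] ev nv dimY neY leY1 leY2.
have inj_r : injective r by case: rk_r.
have [a ra] := ranking_surj rk_r (leq_ltn_trans lelh lthd).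
have [b rb] := ranking_surj rk_r lthd.
have ra_eq j : r j = l -> j = a by rewrite -ra => /inj_r.
have rb_eq j : r j = h -> j = b by rewrite -rb => /inj_r.
have [ltlh|gelh] := ltnP l h; last first.
  have elh : h = l by apply/eqP; rewrite eqn_leq lelh gelh.
  move=> {leY1 b rb rb_eq}.
  rewrite {h gelh lelh}elh subnn in lthd dimY neY leY2 *.
  have [|Y eY sY] := xi_below _ leY2; first by apply: contra_eq_neq dimY => ->.
  move: dimY neY; rewrite {y leY2}eY frank_xi => -[dimY] neY.
  have nY i : Y i != None.
    apply/negP=> Yi; move/eqP: dimY; rewrite cards_eq0 => /eqP/setP/(_ i).
    by rewrite !inE Yi.
  have vY i : r i != l -> Y i = Some (v i).
    move=> ri; have /forallP/(_ i) := sY; rewrite ffunE.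
    by rewrite (_ : (l <= _ < _) = false) => [/eqP//|]; lia.
  (* On an edge, the sign in position [l] decides between the two endpoints, and the sign of [v]
     gives the excluded one. *)
  have [Ya|Ya] := eqVneq (Y a) (Some (v a)).
    case/eqP: neY; congr xi; apply/ffunP=> j.
    rewrite ffunE (_ : (_ <= _ < _) = false); last lia.
    by have [/ra_eq->|/vY] := eqVneq (r j) l.
  congr xi; apply/ffunP=> j; rewrite ffunE (_ : (_ < _ < _) = false); last lia.
  have [rj|rj] := eqVneq (r j) l; last by rewrite vY ?ev.
  rewrite nv // (ra_eq _ rj).
  by case: (Y a) (nY a) Ya => [c|//] _; case: c (v a) => [] [].
have sAB : fsub (arc w r l.+1 h) (arc v r l h.+1).
  by apply: fsub_arc => i; [lia | move=> ni; apply: ev; lia].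
have [Y [eY sAY sYB]] := xi_between sAB (leY1 ltlh) leY2.
move: dimY neY; rewrite {y leY1 leY2}eY frank_xi => -[dimY] neY.
have Yin i : l < r i < h -> Y i = None.
  move=> ri; have /forallP/(_ i) := sAY; rewrite ffunE ri orbC eq_sym orbb.
  by move/eqP.
have Yout i : ~~ (l <= r i <= h) -> Y i = Some (w i).
  move=> ri; have /forallP/(_ i) := sYB; rewrite ffunE ltnS (negPf ri) /=.
  by move/eqP->; rewrite ev //; lia.
have Yend i : r i = l \/ r i = h -> Y i = None \/ Y i = Some (w i).
  move=> ri; have /forallP/(_ i) := sAY; rewrite ffunE.
  rewrite (_ : (_ < _ < _) = false); last by lia.
  by case/orP=> /eqP; auto.
(* Only positions [l] and [h] are undecided, and [Y] is determined by which of them are free. The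
   dimension requires exactly one of them to be free, and [neY] excludes that it is [l]. *)
have Yarc l' h' : (l' = l \/ l' = l.+1) -> (h' = h \/ h' = h.+1) ->
    (Y a == None) = (l' == l) -> (Y b == None) = (h' == h.+1) ->
    Y = arc w r l' h'.
  move=> el eh Ya Yb; apply/ffunP=> i; rewrite ffunE.
  have [ri|ri] := eqVneq (r i) l.
    rewrite (ra_eq _ ri) ra.
    have [e|e] := Yend a (or_introl ra); move: Ya; rewrite e.
      by rewrite eqxx => /esym/eqP ?; rewrite (_ : _ <= _ < _) //; lia.
    by move=> /= /esym/negbT ?; rewrite (_ : (_ <= _ < _) = false) //; lia.
  have [rih|rih] := eqVneq (r i) h.
    rewrite (rb_eq _ rih) rb.
    have [e|e] := Yend b (or_intror rb); move: Yb; rewrite e.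
      by rewrite eqxx => /esym/eqP ?; rewrite (_ : _ <= _ < _) //; lia.
    by move=> /= /esym/negbT ?; rewrite (_ : (_ <= _ < _) = false) //; lia.
  case: ifP => ni; first by apply: Yin; lia.
  by apply: Yout; lia.
have [Ya|Ya] := boolP (Y a == None); have [Yb|Yb] := boolP (Y b == None).
- move: dimY; rewrite (Yarc l h.+1) ?Ya ?Yb ?eqxx; auto.
  by rewrite fdim_arc //; lia.
- case/eqP: neY; congr xi; rewrite (Yarc l h) ?(negPf Yb) ?Ya ?eqxx; auto.
    by apply: eq_arc => // i ni; apply: ev; lia.
  by lia.
- by congr xi; apply: Yarc; rewrite ?(negPf Ya) ?Yb; auto; lia.
move: dimY; rewrite (Yarc l.+1 h) ?(negPf Ya) ?(negPf Yb); auto; [|lia|lia].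
by rewrite fdim_arc //; lia.
Qed.

End Arcs.

(** * Flags as signed orderings of the coordinates *)

Section Rotation.
Variable d : nat.
Implicit Types (r : 'I_d -> nat) (s : nat).

(** For a ranking and [s <= d], the representative in [0, d) of r - s modulo d. *)
Definition shift r s : 'I_d -> nat :=
  fun i => if r i < s then r i + d - s else r i - s.

Lemma shiftP r s i :
  r i < s /\ shift r s i = r i + d - s \/ s <= r i /\ shift r s i = r i - s.
Proof. by rewrite /shift; case: ltnP; auto. Qed.

Lemma shift0 r : shift r 0 =1 r.
Proof. by move=> i; rewrite /shift ltn0 subn0. Qed.

Lemma ranking_shift r s : ranking r -> s <= d -> ranking (shift r s).
Proof.
case=> inj_r ltr lesd; split=> [i j|i]; last first.
  by rewrite /shift; have := ltr i; case: ifP; lia.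
have := ltr i; have := ltr j; rewrite /shift => lti ltj e.
by apply: inj_r; move: e; do 2!case: ifP; lia.
Qed.

(** The representative in [0, d) of -2 - r modulo d; the last position, d - 1, is kept. *)
Definition rank_rev r : 'I_d -> nat :=
  fun i => if r i == d.-1 then d.-1 else d.-2 - r i.

Lemma rank_revP r i :
  r i = d.-1 /\ rank_rev r i = d.-1 \/
  r i <> d.-1 /\ rank_rev r i = d.-2 - r i.
Proof. by rewrite /rank_rev; case: eqP; auto. Qed.

Lemma ranking_rev r : ranking r -> ranking (rank_rev r).
Proof.
case=> inj_r ltr; split=> [i j|i]; last first.
  by have := ltr i; rewrite /rank_rev; case: ifP; lia.
have := ltr i; have := ltr j; rewrite /rank_rev => lti ltj e.
by apply: inj_r; move: e; do 2!case: ifP; lia.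
Qed.

End Rotation.

Section Codes.
Variable d : nat.
Implicit Types (v w : 'I_d -> bool) (r : 'I_d -> nat) (f g : flag d).

(* [v] is determined by [f] only up to a global sign. *)
Definition coded f v r : Prop :=
  ranking r /\ forall k, k <= d -> fnth f k.+1 = xi (arc v r 0 k).

Lemma coded_ext f v w r r' :
  v =1 w -> r =1 r' -> coded f v r -> coded f w r'.
Proof.
move=> ev er [[inj_r ltr] fE]; split.
  by split=> [i j|i]; rewrite -!er //; apply: inj_r.
by move=> k lekd; rewrite fE //; congr xi; apply: eq_arc => i; rewrite ?er ?ev.
Qed.

Lemma coded_opp f v r : coded f v r -> coded f (fun i => ~~ v i) r.
Proof.
by case=> rk_r fE; split=> // k lekd; rewrite fE // -fopp_arc xi_fopp.
Qed.

Lemma coded_inj f g v r : coded f v r -> coded g v r -> f = g.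
Proof.
move=> [_ fE] [_ gE]; apply: flag_ext => k ltkd.
by rewrite fE ?gE // ltnW.
Qed.

(** Free coordinates do not depend on the representative and determine the ordering; the vertex of
    the flag determines the sign vector up to negation. *)
Lemma coded_uniq f v w r r' : coded f v r -> coded f w r' ->
  r =1 r' /\ (v =1 w \/ v =1 (fun i => ~~ w i)).
Proof.
move=> [[_ ltr] fE] [[_ ltr'] fE']; split=> [i|].
  have lt_eq k : k <= d -> (r i < k) = (r' i < k).
    move=> lekd; have := fE _ lekd; rewrite fE' // => /xi_eq.
    by case=> [] /ffunP/(_ i); rewrite ?fopp_arc !ffunE /=;
      do 2![case: ifP => // _].
  have := lt_eq _ (ltr i); have := lt_eq _ (ltr' i); rewrite !ltnS !leqnn.
  by move=> le1 /esym le2; apply/eqP; rewrite eqn_leq le1 le2.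
have := fE 0 isT; rewrite fE' // => /xi_eq[]/ffunP e; [left|right] => i;
  by move: (e i); rewrite ?fopp_arc !ffunE !ltn0 => -[->]; rewrite ?negbK.
Qed.

Lemma coded_exists v r : ranking r -> exists f, coded f v r.
Proof.
move=> rk_r; have ltr : forall i, r i < d by case: rk_r.
pose x k := if k is k'.+1 then xi (arc v r 0 k') else FBot.
have [||k|k|f fE] := @flag_of_fun d x; last first.
- by exists f; split=> // k lekd; rewrite fE.
- case: k => [|k] //= lekd; apply: fle_arc => i //=; lia.
- by case: k => [|k] //= lekd; rewrite frank_arc // subn0.
- rewrite /= xi_improper // negb_exists; apply/forallP=> i.
  by rewrite negbK arc_eqNone ltr.
by [].
Qed.

Hypothesis d_gt2 : 2 < d.

Let d_gt1 : 1 < d. Proof. exact: ltnW. Qed.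

(** Take for [v] one of the two vertices of the cube that represent the vertex of [f], and represent
    every further element by a face containing it. Such a face is determined by its set [S k] of
    free coordinates. These sets increase with [#|S k| = k], and [r] records the order in which the
    coordinates enter. *)
Lemma coded_surj f : exists v r, coded f v r.
Proof.
have [F0 eF0] : exists F, fnth f 1 = xi F.
  apply: xi_surj.
  by apply: contra_eq_neq (frank_fnth f (isT : 1 <= d.+1)) => ->.
pose v i := F0 i == Some true.
pose S k := ffree (fnth f k.+1).
have nb k : k <= d -> fnth f k.+1 != FBot.
  by move=> lekd; apply: contra_eq_neq (@frank_fnth d f k.+1 lekd) => ->.
have cardS k : k <= d -> #|S k| = k.
  by move=> lekd; apply: succn_inj; rewrite -card_ffree ?nb // frank_fnth.
have F0v i : F0 i = Some (v i).
  have /eqP := cardS 0 isT; rewrite cards_eq0 => /eqP/setP/(_ i).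
  by rewrite /S eF0 ffree_xi inE /v; case: (F0 i) => [[]|].
have subS k l : k <= l -> l <= d -> S k \subset S l.
  by move=> lekl leld; apply: ffree_le; exact: fle_fnth.
have fS k : k <= d ->
    fnth f k.+1 = xi [ffun i => if i \in S k then None else Some (v i)].
  move=> lekd; have [G eG sG] : exists2 G, fnth f k.+1 = xi G & fsub F0 G.
    have := fle_fnth f (isT : 1 <= k.+1) lekd; rewrite eF0 => leF.
    have /xi_surj[G eG] := nb _ lekd; move: leF; rewrite eG fle_xi.
    case/orP=> sF; first by exists G.
    by exists (fopp G); rewrite ?xi_fopp // -fsub_fopp foppK.
  rewrite /S eG; congr xi; apply/ffunP=> i; rewrite ffunE ffree_xi.
  by move: sG => /forallP/(_ i); rewrite F0v; case: eqP => //= _ /eqP.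
pose r i := find (fun k => i \in S k.+1) (iota 0 d).
have Sd i : i \in S d.
  have -> : S d = setT.
    by apply/eqP; rewrite eqEcard subsetT cardsT card_ord cardS /=.
  by rewrite in_setT.
have ltr i : r i < d.
  suff : has (fun k => i \in S k.+1) (iota 0 d) by rewrite has_find size_iota.
  apply/hasP.
  by exists d.-1; [rewrite mem_iota; lia | rewrite prednK //; lia].
have rS i k : k <= d -> (r i < k) = (i \in S k).
  move=> lekd; apply/idP/idP => [ltk|iS].
    apply: (subsetP (subS _ _ ltk lekd)).
    have := @nth_find _ 0 (fun k => i \in S k.+1) (iota 0 d).
    by rewrite nth_iota ?ltr //; apply; rewrite has_find size_iota ltr.
  rewrite ltnNge; apply/negP=> lek; case: k => [|k] in lekd iS lek.
    have /eqP := cardS 0 isT; rewrite cards_eq0 => /eqP/setP/(_ i).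
    by rewrite iS inE.
  have := @before_find _ 0 (fun k => i \in S k.+1) (iota 0 d) k lek.
  by rewrite nth_iota // add0n iS.
exists v, r; split; last first.
  move=> k lekd; rewrite fS //; congr xi; apply/ffunP=> i.
  by rewrite !ffunE rS.
(* Two coordinates with the same position would enter at once and enlarge the set by 2 instead of
   1. *)
split=> // i j eij; apply/eqP/negPn/negP => nij.
have := cardS _ (ltr i); have := cardS _ (ltnW (ltr i)) => c1 c2.
suff : #|S (r i)| + 2 <= #|S (r i).+1| by rewrite c1 c2; lia.
rewrite -[2](_ : #|[set i; j]| = 2); last by rewrite cards2 nij.
rewrite -cardsUI [X in _ + X](_ : _ = 0) ?addn0; last first.
  apply: eq_card0 => k; apply/negP=> /setIP[kS /set2P[] ek];
  by move: kS; rewrite ek -rS ?eij ?ltnn // ltnW // -eij.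
apply: subset_leq_card; rewrite subUset subS //= subUset !sub1set.
by rewrite -!rS // eij ltnS leqnn.
Qed.

(** Induction on [m]: at the next exchange the element below has already been replaced and the one
    above has not, so the interval between them is that of [arc_diamond] with l = 0 and h = m. *)
Lemma coded_fold_sigma f v r m : coded f v r -> m <= d -> forall k, k <= d ->
  fnth (foldl (fun g i => sigma i g) f (iota 1 m)) k.+1 =
    xi (if k < m then arc (fun i => v i (+) (r i < 1)) r 1 k.+1
        else arc v r 0 k).
Proof.
case=> rk_r fE; elim: m => [|m IHm] lemd k lekd; first by rewrite fE.
have -> : iota 1 m.+1 = rcons (iota 1 m) m.+1.
  by rewrite -{1}[m.+1]addn1 iotaD cats1 add1n.
rewrite foldl_rcons.
set g := foldl _ f _ in IHm *.
set w := fun i => _.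
have {}IHm := IHm (ltnW lemd).
have gm1 : fnth g m.+1 = xi (arc v r 0 m) by rewrite IHm ?ltnn // ltnW.
have gm2 : fnth g m.+2 = xi (arc v r 0 m.+1) by rewrite IHm // ltnNge leqnSn.
have gm : 0 < m -> fnth g m = xi (arc w r 1 m).
  by case: (m) lemd IHm => // n lend IHn _; rewrite IHn ?leqnn //; lia.
have ev i : r i != 0 -> w i = v i.
  by rewrite /w ltnS leqn0 => /negPf->; rewrite addbF.
have nv i : r i = 0 -> w i = ~~ v i by rewrite /w => ->; rewrite addbT.
rewrite (@sigma_spec _ g m (xi (arc w r 1 m.+1))) //.
- rewrite eqSS; have [->|nk] := eqVneq k m; first by rewrite ltnSn.
  by rewrite IHm // [in RHS]ltnS [in RHS]leq_eqVlt (negPf nk).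
- by rewrite frank_arc // subSS subn0.
- by rewrite gm1; apply: arc_neq => //; lia.
(* For m = 0 the element below is [FBot], which imposes nothing. *)
- case: (posnP m) => [->|m_gt0]; first by rewrite fnth0.
  by rewrite gm //; apply: fle_arc => // i; lia.
- rewrite gm2; apply: fle_arc => i; first by lia.
  by move=> ni; apply: ev; lia.
move=> z rz nz lez1 lez2; apply: (@arc_diamond _ v) => //.
- by rewrite subn0.
- by rewrite -gm1.
- by move=> m_gt0; rewrite -gm.
by rewrite -gm2.
Qed.

(** In every proper face of the flag of positive dimension the coordinate in position 0 is free, so
    only the vertex sees the change of sign. *)
Lemma coded_sigma1 f v r :
  coded f v r -> coded (sigma 1 f) (fun i => v i (+) (r i < 1)) r.
Proof.
move=> cf; have [rk_r _] := cf; split=> // k lekd.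
have /= -> := @coded_fold_sigma _ _ _ 1 cf (ltnW d_gt1) k lekd.
congr xi; case: (posnP k) => [->|k_gt0].
  by apply: eq_arc => i //; lia.
rewrite ltnNge k_gt0 /=; apply: eq_arc => i //.
by rewrite -leqNgt => lek; rewrite ltnNge (leq_trans k_gt0 lek) addbF.
Qed.

Lemma coded_zT f v r :
  coded f v r -> coded (zT f) (fun i => v i (+) (r i < 1)) (shift r 1).
Proof.
move=> cf; have [rk_r _] := cf; have [_ ltr] := rk_r.
split=> [|k lekd]; first by apply: ranking_shift => //; lia.
rewrite /zT (coded_fold_sigma cf) //; congr xi.
(* For [k = d] the element is the greatest one, which T leaves alone; all coordinates are free on
   both sides. *)
case: (ltnP k d) => [ltkd|ledk].
  by apply: eq_arc => i //; rewrite /shift; have := ltr i; case: ifP; lia.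
have lts i : shift r 1 i < d by rewrite /shift; have := ltr i; case: ifP; lia.
by apply: eq_arc => i; have := lts i; have := ltr i; lia.
Qed.

(** The step from s to s + 1 flips the coordinate that has come to position 0, which is the one in
    position s of [r]. *)
Lemma coded_iter f v r s : coded f v r -> s <= d ->
  coded (iter s (@zT d) f) (fun i => v i (+) (r i < s)) (shift r s).
Proof.
move=> cf; have [[_ ltr] _] := cf; elim: s => [|s IHs] lesd.
  by apply: coded_ext cf => i; rewrite /shift ?ltn0 ?addbF ?subn0.
apply: coded_ext (coded_zT (IHs (ltnW lesd))) => i; have := ltr i;
  rewrite /shift => lti.
  rewrite -addbA; congr (_ (+) _).
  by case: ifP; case: ltnP; case: ltnP => //=; lia.
by do !case: ifP; lia.
Qed.

Lemma iter_zT_d f : iter d (@zT d) f = f.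
Proof.
have [v [r cf]] := coded_surj f; have [[_ ltr] _] := cf.
apply: coded_inj (coded_opp cf).
apply: coded_ext (coded_iter cf (leqnn d)) => i; first by rewrite ltr addbT.
by rewrite /shift ltr addnK.
Qed.

(** * The triangular family of a flag and the reverse flag *)

Lemma reverse_familyP f (x : nat -> nat -> fcube d) :
  reverse_family f x <->
  forall i l, l + i < d ->
    [/\ l = 0 -> x i.+1 l.+1 = fnth f i.+1,
        frank (x i.+1 l.+1) = i.+1,
        (l + i.+1 < d -> fle (x i.+1 l.+1) (x i.+2 l.+1)),
        (0 < l -> fle (x i.+1 l.+1) (x i.+2 l))
      & (0 < l -> x i.+1 l.+1 != x i.+1 l)].
Proof.
split=> [xP i l ltd|xP].
  have lti : i.+1 < d.+2 by lia.
  have ltl : l.+1 < d.+2 by lia.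
  move: xP => /forallP/(_ (Ordinal lti))/forallP/(_ (Ordinal ltl))/implyP.
  have -> : [&& 0 < Ordinal lti, 0 < Ordinal ltl &
                Ordinal lti + Ordinal ltl <= d.+1] by rewrite /=; lia.
  move=> /(_ isT)/and5P[/= x1 rx le1 le2 nx]; split.
  - by move=> l0; apply/eqP; move: x1; rewrite l0.
  - exact/eqP.
  - by move=> ltd'; move: le1; rewrite (_ : _ <= _) //; lia.
  - by move=> l0; move: le2; rewrite ltnS l0.
  - by move=> l0; move: nx; rewrite ltnS l0.
apply/forallP=> -[i lti]; apply/forallP=> -[l ltl]; apply/implyP=> /= /and3P[].
case: i lti => // i lti _; case: l ltl => // l ltl _ ltd.
have [|x1 rx le1 le2 nx] := xP i l; first by lia.
apply/and5P; rewrite ltnS rx eqxx; split=> //; apply/implyP=> //.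
  by move=> /eqP[/x1->].
by move=> ltd'; apply: le1; lia.
Qed.

(** When [v] and [r] code [f] and [l <= d], this is the sign vector of T^l f found in
    [coded_iter]. *)
Definition vsign v r l : 'I_d -> bool := fun i => v i (+) (r i < l).

Lemma vsignS v r l i : r i != l -> vsign v r l.+1 i = vsign v r l i.
Proof. by rewrite /vsign ltnS leq_eqVlt => /negPf->. Qed.

Lemma vsignSN v r l i : r i = l -> vsign v r l.+1 i = ~~ vsign v r l i.
Proof. by move=> ri; rewrite /vsign ri ltnSn ltnn addbT addbF. Qed.

(** Column j consists of the elements of T^(j-1) f, as far as the index range goes: free positions
    start at j - 1. The predecessors are there because i and j start at 1. *)
Definition reversal_entry v r (i j : nat) : fcube d :=
  xi (arc (vsign v r j.-1) r j.-1 (j.-1 + i.-1)).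

(** Double induction, on the column and then on the dimension. An entry lies above its predecessor
    in the same column and below the next larger entry of the preceding column; in this interval it
    is the element other than its left neighbour. *)
Lemma reversal_entry_unique f v r x : coded f v r -> reverse_family f x ->
  forall l i, l + i < d -> x i.+1 l.+1 = reversal_entry v r i.+1 l.+1.
Proof.
move=> [rk_r fE] /reverse_familyP xP; elim=> [|l IHl] i.
  rewrite add0n => ltid; have [-> // _ _ _ _] := xP i 0 ltid.
  rewrite fE; last exact: ltnW.
  by congr xi; apply: eq_arc => j // _; rewrite /vsign ltn0 addbF.
(* In dimension 0 there is no entry below, and the interval consists of the two vertices of an
   edge. *)
elim: i => [|i IHi] ltd; rewrite /reversal_entry /= addSn.
  apply: (@arc_diamond _ (vsign v r l)) => //; first by lia.
  - by move=> j; apply: vsignS.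
  - by move=> j; apply: vsignSN.
  - have [_ -> // _ _ _] := xP 0 l.+1 ltd; lia.
  - have [_ _ _ _ /(_ isT)] := xP 0 l.+1 ltd.
    by rewrite IHl //; lia.
  - by lia.
  have [_ _ _ /(_ isT) + _] := xP 0 l.+1 ltd.
  by rewrite IHl /reversal_entry /= ?addnS ?addn0 //; lia.
apply: (@arc_diamond _ (vsign v r l)) => //; first by lia.
- by move=> j; apply: vsignS.
- by move=> j; apply: vsignSN.
- have [_ -> // _ _ _] := xP i.+1 l.+1 ltd; lia.
- have [_ _ _ _ /(_ isT)] := xP i.+1 l.+1 ltd.
  by rewrite IHl //; lia.
- move=> _; have [|_ _ /(_ ltd) + _ _] := xP i l.+1; first by lia.
  by rewrite IHi ?addnS //; lia.
have [_ _ _ /(_ isT) + _] := xP i.+1 l.+1 ltd.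
by rewrite IHl /reversal_entry /= ?addnS //; lia.
Qed.

Lemma reversal_entry_family f v r x : coded f v r ->
  (forall l i, l + i < d -> x i.+1 l.+1 = reversal_entry v r i.+1 l.+1) ->
  reverse_family f x.
Proof.
move=> [rk_r fE] xE; apply/reverse_familyP => i l ltd.
rewrite xE //; split.
- move=> ->; rewrite fE; last by lia.
  by congr xi; apply: eq_arc => j // _; rewrite /vsign ltn0 addbF.
- rewrite frank_arc /=; [lia|done|lia].
- by move=> ltd'; rewrite xE //; apply: fle_arc => j //=; lia.
- case: l ltd => // l ltd _; rewrite xE ?addnS //.
  apply: fle_arc => j /=; first by lia.
  by move=> nj; apply: vsignS; lia.
case: l ltd => // l ltd _; rewrite xE; last by lia.
rewrite /reversal_entry /= addSn; apply: arc_neq => //; first by lia.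
  by move=> j; apply: vsignS.
by move=> j; apply: vsignSN.
Qed.

(** The element of dimension k of the reverse is the entry (k + 1, d - k), with free positions [d -
    1 - k, d - 1). Thus positions become free in the order d - 2, ..., 0, d - 1, and on the fixed
    ones the signs agree with those of the vertex, the entry (1, d). *)
Lemma coded_rev f v r :
  coded f v r -> coded (flag_rev f) (vsign v r d.-1) (rank_rev r).
Proof.
move=> cf; have [rk_r _] := cf; have [_ ltr] := rk_r.
have [g cg] := coded_exists (vsign v r d.-1) (ranking_rev rk_r).
have gE k : k < d -> fnth g k.+1 = reversal_entry v r k.+1 (d - k).
  move=> ltkd; case: cg => _ ->; last exact: ltnW.
  congr xi; apply: eq_arc => i; rewrite /rank_rev; have := ltr i.
    by case: ifP => /eqP; lia.
  move=> lti; rewrite /vsign => ni; congr (_ (+) _); move: ni.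
  by case: ifP => /eqP; lia.
rewrite /flag_rev; case: pickP => [h /=|/(_ g) /= gP]; last first.
  pose x := [ffun p : 'I_d.+2 * 'I_d.+2 => reversal_entry v r p.1 p.2].
  have xE i j : i < d.+2 -> j < d.+2 ->
      x (inord i, inord j) = reversal_entry v r i j.
    by move=> lti ltj; rewrite ffunE /= !inordK.
  suff : is_reverse f g by rewrite gP.
  apply/existsP; exists x; apply/andP; split.
    by apply: (reversal_entry_family cf) => l i ltd; rewrite xE //; lia.
  apply/forallP=> -[[|k] ltk] //=; apply/implyP=> lekd.
  by rewrite gE // xE // subSS; lia.
move=> /existsP[x /andP[xP /forallP hP]].
suff -> : h = g by [].
apply: flag_ext => k ltkd; rewrite gE //.
have ltk : k.+1 < d.+2 by lia.
have := hP (Ordinal ltk); rewrite /= ltkd => /eqP->.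
have -> : d.+1 - k.+1 = (d - k).-1.+1 by lia.
rewrite (reversal_entry_unique cf xP); last by lia.
by rewrite prednK //; lia.
Qed.
End Codes.

(** * Zigzags *)

Section Zigzags.
Variable d : nat.
Hypothesis d_gt2 : 2 < d.
Implicit Types (v w : 'I_d -> bool) (r : 'I_d -> nat) (f g : flag d).
Implicit Types (Z : {set flag d}) (C : {set {set flag d}}).

Let d_gt0 : 0 < d. Proof. exact: ltn_trans d_gt2. Qed.

(** Reversal flips all signs except the one in position d - 1, and it keeps that position; done
    twice, it changes no sign. *)
Lemma flag_revK : involutive (@flag_rev d).
Proof.
move=> f; have [v [r cf]] := coded_surj d_gt2 f; have [[_ ltr] _] := cf.
refine (coded_inj _ cf).
apply: coded_ext (coded_rev d_gt2 (coded_rev d_gt2 cf)) => i; have := ltr i;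
  rewrite /vsign /rank_rev => lti.
  rewrite -addbA [X in _ (+) X](_ : _ = false) ?addbF //.
  by case: ifP; case: ltnP; case: ltnP => //=; lia.
by do 2!case: ifP; lia.
Qed.

(** Reversal conjugates T to its inverse; on positions, (-2 - (r - 1)) - 1 = -2 - r modulo d. *)
Lemma zT_rev f : zT (flag_rev (zT f)) = flag_rev f.
Proof.
have [v [r cf]] := coded_surj d_gt2 f; have [[_ ltr] _] := cf.
apply: coded_inj (coded_rev d_gt2 cf).
apply: coded_ext (coded_zT d_gt2 (coded_rev d_gt2 (coded_zT d_gt2 cf))) => i;
  have := ltr i; have := rank_revP r i; have := shiftP r 1 i;
  have := rank_revP (shift r 1) i;
  have := shiftP (rank_rev (shift r 1)) 1 i; last by lia.
move=> _ e1 e2 _ lti; rewrite /vsign -!addbA; congr (_ (+) _).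
by move: (r i) (shift r 1 i) (rank_rev _ i) e1 e2 lti => x y z; lia.
Qed.

Lemma iter_zT_rev s f :
  iter s (@zT d) (flag_rev (iter s (@zT d) f)) = flag_rev f.
Proof.
elim: s => //= s IHs.
by rewrite -iterS iterSr zT_rev.
Qed.

Lemma iter_zT_inj f s t :
  s < d -> t < d -> iter s (@zT d) f = iter t (@zT d) f -> s = t.
Proof.
move=> lts ltt est; have [v [r cf]] := coded_surj d_gt2 f; have [rk_r _] := cf.
(* After s steps this coordinate is in position -s modulo d, which determines s. *)
have [a ra] := ranking_surj rk_r d_gt0.
have cs := coded_iter d_gt2 cf (ltnW lts).
have := coded_iter d_gt2 cf (ltnW ltt); rewrite -est => /(coded_uniq cs)[+ _].
by move=> /(_ a); rewrite /shift ra; do 2!case: ifP; lia.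
Qed.

Lemma zigzagP f g :
  reflect (exists2 s, s < d & g = iter s (@zT d) f) (g \in zigzag_of f).
Proof.
rewrite inE -fconnect_orbit; apply: (iffP idP) => [/iter_findex <-|[s _ ->]].
  move: (findex _ _ _) => s; exists (s %% d); first by rewrite ltn_mod.
  have fixf : iter (s %/ d) (iter d (@zT d)) f = f.
    by apply: iter_fix; apply: iter_zT_d.
  by rewrite {1}(divn_eq s d) addnC iterD iterM fixf.
exact: fconnect_iter.
Qed.

Lemma zigzag_refl f : f \in zigzag_of f.
Proof. by apply/zigzagP; exists 0. Qed.

Lemma card_zigzag f : #|zigzag_of f| = d.
Proof.
have -> : zigzag_of f = [set iter (s : nat) (@zT d) f | s : 'I_d].
  apply/setP=> g; apply/zigzagP/imsetP => [[s lts ->]|[s _ ->]].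
    by exists (Ordinal lts).
  by exists (s : nat).
rewrite card_imset ?card_ord // => s t /iter_zT_inj e.
by apply: val_inj; apply: e.
Qed.

Lemma eq_zigzag f g : (zigzag_of g == zigzag_of f) = (g \in zigzag_of f).
Proof.
apply/eqP/idP => [<-|]; first exact: zigzag_refl.
case/zigzagP=> s _ ->; apply/eqP; rewrite eqEcard !card_zigzag leqnn andbT.
apply/subsetP=> _ /zigzagP[t _ ->]; rewrite -iterD inE -fconnect_orbit.
exact: fconnect_iter.
Qed.

Lemma zrev_zigzag f : zrev (zigzag_of f) = zigzag_of (flag_rev f).
Proof.
apply/eqP; rewrite eqEcard card_imset; last exact: can_inj flag_revK.
rewrite !card_zigzag leqnn andbT.
apply/subsetP=> _ /imsetP[g /zigzagP[s lts ->] ->].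
rewrite -eq_zigzag eq_sym eq_zigzag; apply/zigzagP; exists s => //.
by rewrite iter_zT_rev.
Qed.

Lemma zrevK : involutive (@zrev d).
Proof.
move=> Z; rewrite /zrev -imset_comp (eq_imset (g := id)) ?imset_id //.
exact: flag_revK.
Qed.

(* For [d > 2] the cyclic order in which the coordinates occur along a zigzag
   differs from the opposite cyclic order. *)
Lemma shift_neq_rev r s t : ranking r -> s < d -> t < d ->
  ~ (shift r s =1 rank_rev (shift r t)).
Proof.
move=> rk_r lts ltt est; have [_ ltr] := rk_r.
have rk_s := ranking_shift rk_r (ltnW lts).
(* Here [b] directly follows [a] in the cyclic order of [r]; equality with a reversed ordering would
   make it directly precede [a] too, so that 2 = 0 modulo d. *)
have [a sa] := ranking_surj rk_s d_gt0.
have [b sb] := ranking_surj rk_s (ltnW d_gt2).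
have lta := ltr a; have ltb := ltr b.
have ra : r a = s by have := shiftP r s a; rewrite sa; lia.
have rb : r b = s.+1 \/ s = d.-1 /\ r b = 0.
  by have := shiftP r s b; rewrite sb; lia.
have ta : shift r t a = d.-2.
  have := rank_revP (shift r t) a; have := shiftP r t a.
  by rewrite -est sa; lia.
have tb : shift r t b = d - 3.
  have := rank_revP (shift r t) b; have := shiftP r t b.
  by rewrite -est sb; lia.
by have := shiftP r t a; have := shiftP r t b; rewrite ta tb ra; lia.
Qed.

(** Only the cyclic ordering of [g] matters and [w] is arbitrary, so this applies to [sigma 1 f] as
    well as to the flags of the zigzag. *)
Lemma notin_zrev f g v w r s : coded f v r -> coded g w (shift r s) -> s < d ->
  g \notin zrev (zigzag_of f).
Proof.
move=> cf cg lts; apply/imsetP => -[_ /zigzagP[t ltt ->] eg].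
have [rk_r _] := cf.
have ct := coded_rev d_gt2 (coded_iter d_gt2 cf (ltnW ltt)).
rewrite -eg in ct; have [est _] := coded_uniq cg ct.
exact: shift_neq_rev rk_r lts ltt est.
Qed.

Lemma zrev_disjoint f g : g \in zigzag_of f -> g \notin zrev (zigzag_of f).
Proof.
case/zigzagP=> s lts ->; have [v [r cf]] := coded_surj d_gt2 f.
exact: notin_zrev cf (coded_iter d_gt2 cf (ltnW lts)) lts.
Qed.

Lemma sigma1_notin f : sigma 1 f \notin zigzag_of f.
Proof.
have [v [r cf]] := coded_surj d_gt2 f; have [rk_r _] := cf.
apply/negP=> /zigzagP[s lts].
have cs := coded_iter d_gt2 cf (ltnW lts).
move=> es; rewrite -es in cs.
have [er ev] := coded_uniq (coded_sigma1 d_gt2 cf) cs.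
(* The position of [a] forces s = 0; then the sign vectors differ at [a] and agree at [b], so they
   are neither equal nor opposite. *)
have [a ra] := ranking_surj rk_r d_gt0.
have [b rb] := ranking_surj rk_r (ltnW d_gt2).
have {er lts} s0 : s = 0 by have := er a; rewrite /shift ra; case: ifP; lia.
case: ev => ev; [have := ev a | have := ev b];
  by rewrite s0 ?ra ?rb; case: (v _).
Qed.

Lemma sigma1_notin_zrev f : sigma 1 f \notin zrev (zigzag_of f).
Proof.
have [v [r cf]] := coded_surj d_gt2 f.
apply: (notin_zrev cf (s := 0)) => //.
apply: coded_ext (coded_sigma1 d_gt2 cf) => // i; exact/esym/shift0.
Qed.

Definition class_of f : {set {set flag d}} := zclass (zigzag_of f).

Lemma eq_class_of f g :
  (class_of g == class_of f) =
    (g \in zigzag_of f :|: zrev (zigzag_of f)).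
Proof.
rewrite inE zrev_zigzag -!eq_zigzag -zrev_zigzag; apply/eqP/orP.
  move=> e; have : zigzag_of g \in class_of f by rewrite -e set21.
  by case/set2P=> ->; rewrite eqxx; auto.
rewrite /class_of /zclass; case=> /eqP-> //.
by rewrite zrevK setUC.
Qed.

(** With g = T^s f, comparing orderings shows that [sigma 1 g] could only be T^s of [sigma 1 f]. For
    s > 0 the sign vectors of these two flags differ exactly in the positions 0 and s of [r], so
    they are neither equal nor opposite, as d > 2. *)
Lemma class_sigma1_inj f g : g \in zigzag_of f ->
  class_of (sigma 1 g) = class_of (sigma 1 f) -> g = f.
Proof.
case/zigzagP=> s lts ->; move/eqP; rewrite eq_class_of.
have [v [r cf]] := coded_surj d_gt2 f; have [rk_r _] := cf.
have csg := coded_sigma1 d_gt2 (coded_iter d_gt2 cf (ltnW lts)).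
have csf := coded_sigma1 d_gt2 cf.
rewrite inE (negPf (notin_zrev csf csg lts)) orbF => /zigzagP[t ltt est].
have := coded_iter d_gt2 csf (ltnW ltt); rewrite -est => ct.
have [er ev] := coded_uniq csg ct; have [_ ltr] := rk_r.
have [a ra] := ranking_surj rk_r d_gt0.
have {ct est} ets : s = t.
  by move: (er a) lts ltt; rewrite /shift ra; do 2!case: ifP; lia.
rewrite -{t}ets in ltt er ev.
have [->//|s_gt0] := posnP s; exfalso.
have [b rb] := ranking_surj rk_r lts.
(* A third position, other than 0 and s, where the two sign vectors agree. *)
have [c rc] : exists c, r c = if s == 1 then 2 else 1.
  by apply: ranking_surj => //; case: ifP; lia.
case: ev => ev.
  have := ev a; rewrite /shift ra s_gt0 /=.
  rewrite (_ : _ + d - s < 1 = false); last by lia.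
  by case: (v a).
have := ev c; rewrite /shift rc; have [->|ns1] := eqVneq s 1.
  by case: (v c).
rewrite (_ : 1 < s) /=; last by lia.
by rewrite (_ : _ + d - s < 1 = false); [case: (v c)|lia].
Qed.

End Zigzags.

(** * Counting *)

Lemma card_uniform_fibers (A B : finType) (h : A -> B) (k : nat) :
  (forall x, #|[set y | h y == h x]| = k) -> #|A| = #|h @: setT| * k.
Proof.
move=> hk; rewrite -cardsT -sum1_card (partition_big_imset h) /=.
rewrite -sum_nat_const; apply: eq_bigr => _ /imsetP[x _ ->].
rewrite -(hk x) -sum1_card; apply: eq_bigl => y.
by rewrite !inE.
Qed.

Section Counting.
Variable d : nat.
Hypothesis d_gt2 : 2 < d.
Implicit Types (f g : flag d) (Z : {set flag d}) (C : {set {set flag d}}).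

Lemma ranking_perm (p : {perm 'I_d}) : ranking (fun i => p i : nat).
Proof. by split=> // i j /val_inj/perm_inj. Qed.

(** Coding maps pairs of a sign vector and a permutation onto the flags, and each fibre is a pair
    with opposite sign vectors. *)
Lemma card_flag : #|flag d| * 2 = 2 ^ d * d`!.
Proof.
pose code : finType := ({ffun 'I_d -> bool} * {perm 'I_d})%type.
pose codedb (c : code) f := [forall k : 'I_d.+1,
  fnth f k.+1 == xi (arc c.1 (fun i => c.2 i : nat) 0 k)].
have codedP (c : code) f :
    reflect (coded f c.1 (fun i => c.2 i : nat)) (codedb c f).
  apply: (iffP forallP) => [cf|[_ cf] k]; last by rewrite cf // -ltnS.
  split=> [|k lekd]; first exact: ranking_perm.
  by have /eqP := cf (Ordinal (lekd : k < d.+1)).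
have code_ex (c : code) : exists f, codedb c f.
  have [f cf] := coded_exists c.1 (ranking_perm c.2).
  by exists f; apply/codedP.
pose h c := xchoose (code_ex c).
have hP (c : code) : coded (h c) c.1 (fun i => c.2 i : nat).
  by apply/codedP; apply: xchooseP.
have <- : #|h @: setT| = #|flag d|.
  rewrite -cardsT; congr #|pred_of_set _|; apply/setP=> f; rewrite inE.
  have [v [r cf]] := coded_surj d_gt2 f; have [[inj_r ltr] _] := cf.
  have inj_p : injective (fun i => Ordinal (ltr i)).
    by move=> i j /(congr1 val)/inj_r.
  apply/imsetP; exists ([ffun i => v i], perm inj_p) => //.
  apply: (coded_inj _ (hP _)); apply: coded_ext cf => i /=.
    by rewrite ffunE.
  by rewrite permE.
rewrite -(@card_uniform_fibers code _ h 2).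
  by rewrite card_prod card_ffun card_bool card_ord card_Sn.
move=> [v p]; pose v' : {ffun 'I_d -> bool} := [ffun i => ~~ v i].
have -> : [set c | h c == h (v, p)] = [set (v, p); (v', p)].
  apply/setP=> -[w q]; rewrite in_set.
  apply/eqP/set2P => [e|[[-> ->]|[-> ->]]]; [|exact: erefl|].
    have := hP (w, q); rewrite e => /(coded_uniq (hP (v, p)))[/= eqp evw].
    have <- : p = q by apply/permP=> i; apply: val_inj; apply: eqp.
    case: evw => ev; [left|right]; congr (_, _); apply/ffunP=> i.
      by rewrite ev.
    by rewrite ffunE ev negbK.
  apply: (coded_inj (hP _)); apply: coded_ext (coded_opp (hP _)) => i /=.
    by rewrite ffunE.
  exact: erefl.
rewrite cards2 xpair_eqE eqxx andbT; suff -> : v != v' by [].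
have i0 : 'I_d by apply: (@Ordinal _ 0); exact: leq_trans d_gt2.
by apply/eqP=> /ffunP/(_ i0); rewrite ffunE; case: (v i0).
Qed.

Lemma zigzags_upto_reversalE : zigzags_upto_reversal d = @class_of d @: setT.
Proof.
apply/setP=> C; apply/imsetP/imsetP => [[_ /imsetP[f _ ->] ->]|[f _ ->]].
  by exists f.
by exists (zigzag_of f) => //; apply: imset_f.
Qed.

Lemma card_zigzag_zrev f : #|zigzag_of f :|: zrev (zigzag_of f)| = d.*2.
Proof.
rewrite cardsU zrev_zigzag // !card_zigzag // -zrev_zigzag // addnn.
rewrite (_ : _ :&: _ = set0) ?cards0 ?subn0 //.
apply/setP=> g; rewrite in_setI in_set0; apply/negP=> /andP[gZ]; apply/negP.
exact: zrev_disjoint.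
Qed.

(** Each class accounts for 2d flags, so the number N of classes satisfies 4dN = 2^d d!. *)
Lemma card_zigzags_upto_reversal :
  #|zigzags_upto_reversal d| = 2 ^ (d - 2) * (d - 1)`!.
Proof.
have : #|flag d| = #|@class_of d @: setT| * d.*2.
  apply: card_uniform_fibers => f; rewrite -(card_zigzag_zrev f).
  by apply: eq_card => g; rewrite !inE eq_class_of ?inE.
rewrite zigzags_upto_reversalE => e; have := card_flag; rewrite {}e.
case: d d_gt2 => [|[|n]] // _; rewrite !subSS !subn0 factS -muln2 => e.
apply/eqP; rewrite -(@eqn_pmul2r (n.+2 * 4)) //; apply/eqP.
by move: e; rewrite !expnS; move: #|_| (2 ^ n) n.+1`! => x y z; nia.
Qed.

(** For either orientation the two numbers add up to the number of flags of the zigzag that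
    [sigma 1] sends into the class. By [class_sigma1_inj] this is at most 1, so the minimum is 0 and
    the maximum is the sum. *)
Lemma signature_class f C :
    C \in zigzags_upto_reversal d ->
  signature (zigzag_of f) C =
    (0, (C \in [set class_of (sigma 1 g) | g in zigzag_of f]) : nat).
Proof.
rewrite zigzags_upto_reversalE => /imsetP[g0 _ ->].
rewrite /signature; case: pickP => [Z2 Z2C|/(_ (zigzag_of g0))]; last first.
  by rewrite set21.
(* The picked orientation is that of the zigzag of some [g] in the same class, so both cases become
   one. *)
have {Z2 Z2C}[g -> ->] : exists2 g, class_of g0 = class_of g & Z2 = zigzag_of g.
  case/set2P: Z2C => ->; first by exists g0.
  exists (flag_rev g0); last by rewrite zrev_zigzag.
  apply/eqP; rewrite eq_sym eq_class_of // inE; apply/orP; right.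
  by apply: imset_f; apply: zigzag_refl.
set Z := zigzag_of f; set b := _ \in _.
have nE : nI Z (zigzag_of g) + nII Z (zigzag_of g) = b.
  rewrite /nII /nI -cardsUI [X in _ + X](_ : _ = 0) ?addn0; last first.
    apply: eq_card0 => k; apply/negP=> /setIP[/setIdP[_ kg] /setIdP[_]].
    by apply/negP; apply: zrev_disjoint.
  have -> : [set k in Z | sigma 1 k \in zigzag_of g]
      :|: [set k in Z | sigma 1 k \in zrev (zigzag_of g)]
    = [set k in Z | class_of (sigma 1 k) == class_of g].
    by apply/setP=> k; rewrite 5!inE eq_class_of // in_setU -andb_orr.
  rewrite /b; case: imsetP => [[k kZ ek]|nk] /=.
    apply/eqP/cards1P; exists k; apply/setP=> k'.
    apply/setIdP/set1P => [[k'Z /eqP ek']|->]; last by rewrite ek.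
    apply: class_sigma1_inj (etrans ek' ek) => //.
    rewrite -eq_zigzag //; move: kZ k'Z.
    by rewrite -!eq_zigzag // => /eqP-> /eqP->.
  apply: eq_card0 => k; apply/negP=> /setIdP[kZ /eqP ek].
  by case: nk; exists k.
by congr (_, _); move: nE; case: (b) => /=; lia.
Qed.

Lemma Int_zigzag f : Int (zigzag_of f) = nseq d (0, 1).
Proof.
set H := [set class_of (sigma 1 g) | g in zigzag_of f].
have HD : H \subset zigzags_upto_reversal d :\ zclass (zigzag_of f).
  apply/subsetP=> _ /imsetP[g gZ ->]; rewrite in_setD1; apply/andP; split.
    rewrite -/(class_of f) -(_ : class_of g = class_of f); last first.
      by apply/eqP; rewrite eq_class_of // inE gZ.
    rewrite eq_class_of // inE negb_or sigma1_notin //.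
    exact: sigma1_notin_zrev.
  by rewrite zigzags_upto_reversalE; apply: imset_f.
have cardH : #|H| = d.
  rewrite card_in_imset ?card_zigzag // => g k gZ kZ.
  apply: class_sigma1_inj => //.
  rewrite -eq_zigzag //; move: gZ kZ.
  by rewrite -!eq_zigzag // => /eqP-> /eqP->.
rewrite /Int; set D := _ :\ _ in HD *.
have -> : [seq signature (zigzag_of f) C | C <- enum D]
    = [seq (0, (C \in H) : nat) | C <- enum D].
  apply/eq_in_map => C; rewrite mem_enum => /setD1P[_ CD].
  exact: signature_class.
(* After filtering, every entry is (0, 1), and it remains to count the classes in [H]. *)
set s := filter _ _; have /all_pred1P -> : all (pred1 (0, 1)) s.
  apply/allP=> x; rewrite mem_filter => /andP[+ /mapP[C _ ex]].
  by rewrite {x}ex /=; case: (C \in H).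
congr nseq; apply: etrans cardH.
rewrite size_filter count_map -size_filter cardE.
apply: perm_size; apply: uniq_perm => [||C].
- by apply: filter_uniq; apply: enum_uniq.
- exact: enum_uniq.
rewrite mem_filter !mem_enum /= -[RHS]andbT.
have [CH|//] := boolP (C \in H); exact: subsetP HD _ CH.
Qed.

End Counting.

Theorem proposition4p8 (d : nat) (hd : 3 <= d) :
  [/\ #|zigzags_upto_reversal d| = 2 ^ (d - 2) * (d - 1)`!,
      (forall Z : {set flag d}, Z \in zigzags d ->
         #|Z| = d /\ no_self_intersection Z)
    & (forall Z : {set flag d}, Z \in zigzags d ->
         perm_eq (Int Z) (nseq d (0, 1)))].

Proof.
split=> [|_ /imsetP[f _ ->]|_ /imsetP[f _ ->]].
- exact: card_zigzags_upto_reversal.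
- rewrite card_zigzag //; split=> //; apply/forall_inP => g gZ.
  have <- : zigzag_of g = zigzag_of f by apply/eqP; rewrite eq_zigzag.
  by rewrite inE negb_or sigma1_notin // sigma1_notin_zrev.
by rewrite Int_zigzag.
Qed.
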